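(* Let $n\ge 2$ and let $\boldsymbol{\omega}=(\omega_1,\dots,\omega_n)$ be a positive Chebyshev system on an interval $I\subset\mathbb{R}$ such that $(\omega_1,\dots,\omega_{n-1})$ is also a positive Chebyshev system on $I$. A function $f:I\to\mathbb{R}$ is $\boldsymbol{\omega}$-$n$-convex if and only if for all $x_1,\dots,x_{n-1}\in I^0$ such that $x_1<\dots<x_{n-1}$ there exist constants $c_1,\dots,c_n\in\mathbb{R}$ such that for $\omega=c_1\omega_1+\dots+c_n\omega_n$ we have $\omega(x_k)=f(x_k)$, $k=1,\dots,n-1$, and $$(-1)^{n-1}\bigl(f(x)-\omega(x)\bigr)\le 0\quad\text{for } x\in I \text{ such that } x<x_1,$$ $$(-1)^{n-k}\bigl(f(x)-\omega(x)\bigr)\le 0\quad\text{for } x_{k-1}<x<x_k,\ k=2,\dots,n-1,$$ $$f(x)-\omega(x)\ge 0\quad\text{for } x\in I \text{ such that } x>x_{n-1}$$ (for $n=2$ the second family of inequalities is empty).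
   Context: Let $I\subset\mathbb{R}$ be an interval, $I^0$ its interior, and $\omega_1,\dots,\omega_n:I\to\mathbb{R}$ continuous functions. For $m\in\{n-1,n\}$ and $m$ distinct points $y_1,\dots,y_m\in I$ put $V_m(y_1,\dots,y_m)=\det\bigl(\omega_i(y_j)\bigr)_{i,j=1}^m$ (row $i$ corresponds to the function $\omega_i$, column $j$ to the point $y_j$). A system $(\omega_1,\dots,\omega_m)$ of continuous functions is a Chebyshev system on $I$ if $V_m(y_1,\dots,y_m)\neq 0$ for all $y_1<\dots<y_m$ in $I$; it is a positive Chebyshev system if $V_m(y_1,\dots,y_m)>0$ for all $y_1<\dots<y_m$ in $I$. For a Chebyshev system $\boldsymbol{\omega}=(\omega_1,\dots,\omega_n)$ on $I$, a function $f:I\to\mathbb{R}$ is $\boldsymbol{\omega}$-$n$-convex if for any $x_1<\dots<x_n$ in $I$ the (uniquely determined) function $\omega=c_1\omega_1+\dots+c_n\omega_n$ (with $c_1,\dots,c_n\in\mathbb{R}$) such that $\omega(x_i)=f(x_i)$, $i=1,\dots,n$, satisfies, for $x\in I$: $(-1)^n(f(x)-\omega(x))\ge 0$ for $x\le x_1$; $(-1)^{n+i}(f(x)-\omega(x))\ge 0$ for $x_i\le x\le x_{i+1}$, $i=1,\dots,n-1$; and $f(x)-\omega(x)\ge 0$ for $x\ge x_n$. *)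

(* Defs.v *)
(* MathComp / MathComp-Analysis *)
From HB Require Import structures.
From mathcomp Require Import all_boot all_order all_algebra.
From mathcomp Require Import boolp classical_sets reals topology normedtype.

Set Implicit Arguments.
Unset Strict Implicit.
Unset Printing Implicit Defensive.

Import Order.TTheory GRing.Theory Num.Theory.
Import numFieldNormedType.Exports.

Local Open Scope classical_set_scope.
Local Open Scope ring_scope.

(* Conventions: a function on I is a total function R -> R of which only the
   values on I are used.  A family indexed by 1, ..., m is indexed by 'I_m,
   that is by 0, ..., m - 1. *)

Definition Vdet (R : realType) (m : nat) (w : 'I_m -> R -> R) (y : 'I_m -> R)
    : R :=
  \det (\matrix_(i < m, j < m) w i (y j)).

Definition increasing_in (R : realType) (A : set R) (m : nat) (y : 'I_m -> R)
    : Prop :=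
  (forall i, A (y i)) /\ (forall i j : 'I_m, (i < j)%N -> y i < y j).

Definition chebyshev_system (R : realType) (I : set R) (m : nat)
    (w : 'I_m -> R -> R) : Prop :=
  (forall i, {within I, continuous (w i)}) /\
  (forall y : 'I_m -> R, increasing_in I y -> Vdet w y != 0).

Definition positive_chebyshev_system (R : realType) (I : set R) (m : nat)
    (w : 'I_m -> R -> R) : Prop :=
  (forall i, {within I, continuous (w i)}) /\
  (forall y : 'I_m -> R, increasing_in I y -> 0 < Vdet w y).

Definition drop_last (R : realType) (n : nat) (w : 'I_n -> R -> R)
    : 'I_n.-1 -> R -> R :=
  fun i => w (widen_ord (leq_pred n) i).

Definition lincomb (R : realType) (n : nat) (w : 'I_n -> R -> R)
    (c : 'I_n -> R) : R -> R :=
  fun t => \sum_(i < n) c i * w i t.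

Lemma positive_chebyshev_chebyshev (R : realType) (I : set R) (m : nat)
    (w : 'I_m -> R -> R) :
  positive_chebyshev_system I w -> chebyshev_system I w.
Proof. by case=> wc wp; split=> // y /wp /gt_eqF ->. Qed.

Lemma interpolation_unique_existence (R : realType) (I : set R) (n : nat)
    (w : 'I_n -> R -> R) (f : R -> R) (x : 'I_n -> R) :
  chebyshev_system I w -> increasing_in I x ->
  exists! c : 'I_n -> R, forall i, lincomb w c (x i) = f (x i).
Proof.
move=> [_ wn] /wn; rewrite /Vdet; set M := (\matrix_(_, _) _) => M0.
have uM : M \in unitmx by rewrite unitmxE unitfE.
have lincE (c : 'I_n -> R) i : lincomb w c (x i) = ((\row_k c k) *m M) 0 i.
  by rewrite mxE; apply: eq_bigr => k _; rewrite !mxE.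
pose F : 'rV[R]_n := \row_i f (x i).
exists (fun i => (F *m invmx M) 0 i); split.
  move=> i; rewrite lincE; set v := \row__ _.
  have -> : v = F *m invmx M by apply/rowP => k; rewrite mxE.
  by rewrite mulmxKV // mxE.
move=> c hc; apply/funext => i.
have -> : F = (\row_k c k) *m M.
  by apply/rowP => k; rewrite -lincE hc mxE.
by rewrite mulmxK // mxE.
Qed.

(* By [interpolation_unique_existence], over a Chebyshev system the quantifier
   on c ranges over exactly one interpolant.  The family (x_1, ..., x_n) is
   shifted by one, so for the pair i, j = i + 1 below the pieces
   x_p <= t <= x_(p+1) correspond to p = j. *)
Definition omega_convex (R : realType) (I : set R) (n : nat)
    (w : 'I_n -> R -> R) (f : R -> R) : Prop :=
  forall x : 'I_n -> R, increasing_in I x ->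
  forall c : 'I_n -> R, (forall i, lincomb w c (x i) = f (x i)) ->
  forall t, I t ->
  [/\ forall i : 'I_n, i = 0%N :> nat -> t <= x i ->
        (-1) ^+ n * (f t - lincomb w c t) >= 0,
      forall i j : 'I_n, j = i.+1 :> nat -> x i <= t <= x j ->
        (-1) ^+ (n + j) * (f t - lincomb w c t) >= 0
    & forall i : 'I_n, i.+1 = n -> x i <= t ->
        f t - lincomb w c t >= 0].

(* Main.v *)
Require Import Defs.
From HB Require Import structures.
From mathcomp Require Import all_boot all_order all_algebra.
From mathcomp Require Import boolp classical_sets reals topology normedtype.

Set Implicit Arguments.
Unset Strict Implicit.
Unset Printing Implicit Defensive.

Import Order.TTheory GRing.Theory Num.Theory.
Import numFieldNormedType.Exports.

Local Open Scope classical_set_scope.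
Local Open Scope ring_scope.

(** Let [gdiff w z f] be the determinant with rows w_1, ..., w_n, f and columns
    z_0 < ... < z_n, expanded along its last row.  It is linear in f, it
    vanishes on the span of w, and the coefficients of the f (z_j) are, up to
    alternating signs, values of [Vdet w] at increasing points, hence positive.
    If f agrees with a combination omega at all the z_j but one, only one term
    of [gdiff w z (f - omega)] survives; so [omega_convex] says exactly that
    [gdiff w z f] is nonnegative for all increasing z ([omega_convexP]).

    If f has supporting combinations, take one, omega, at the inner points
    z_1, ..., z_(n-1), which are interior to I.  Only the two end terms of
    [gdiff w z (f - omega)] survive, and both are nonnegative.

    Conversely, let f be convex and x_1 < ... < x_(n-1) interior points.  The
    combinations that agree with f at the x_i form a line omega0 + c phi, where
    phi t = [Vdet w] (x_1, ..., x_(n-1), t) ([nodal]).  As the sign of phi on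
    each piece is known, the wanted inequalities say that the quotient
    (f - omega0) / phi is at most c to the left of x_(n-1), and at least c to
    its right.  Such a c exists because every value on the left is at most every
    value on the right: this is [gdiff] >= 0 for the x_i together with one point
    on each side ([gdiff_two_inserted]). *)

(** * Points inserted in an increasing family *)

Definition insert_at {R : realType} {m : nat} (k : 'I_m.+1) (s : R)
    (x : 'I_m -> R) : 'I_m.+1 -> R :=
  fun j => if unlift k j is Some i then x i else s.

Definition in_gap {R : realType} {m : nat} (x : 'I_m -> R) (k : nat) (s : R)
    : Prop :=
  forall i : 'I_m, if (i < k)%N then x i < s else s < x i.

Lemma insert_at_lift (R : realType) m (k : 'I_m.+1) (s : R) (x : 'I_m -> R) i :
  insert_at k s x (lift k i) = x i.
Proof. by rewrite /insert_at liftK. Qed.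

Lemma insert_at_same (R : realType) m (k : 'I_m.+1) (s : R) (x : 'I_m -> R) :
  insert_at k s x k = s.
Proof. by rewrite /insert_at unlift_none. Qed.

Lemma insert_at_comp_lift (R : realType) m (k : 'I_m.+1) (s : R)
    (x : 'I_m -> R) :
  insert_at k s x \o lift k = x.
Proof. by apply/funext => i /=; rewrite insert_at_lift. Qed.

Lemma increasing_le (R : realType) (A : set R) m (x : 'I_m -> R) (i j : 'I_m) :
  increasing_in A x -> (i <= j)%N -> x i <= x j.
Proof.
case=> _ xlt; rewrite leq_eqVlt => /orP[/eqP ij|/xlt /ltW //].
by rewrite (ord_inj ij).
Qed.

Lemma ltn_bump2 h i j : (bump h i < bump h j)%N = (i < j)%N.
Proof. by rewrite !ltnNge leq_bump2. Qed.

Lemma increasing_lift (R : realType) (A : set R) m (z : 'I_m.+1 -> R) k :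
  increasing_in A z -> increasing_in A (z \o lift k).
Proof.
move=> [zA zlt]; split=> [i|i j ij] /=; first exact: zA.
by apply: zlt; rewrite /= ltn_bump2.
Qed.

Lemma increasing_insert (R : realType) (A : set R) m (x : 'I_m -> R)
    (k : 'I_m.+1) s :
  increasing_in A x -> A s -> in_gap x k s -> increasing_in A (insert_at k s x).
Proof.
move=> [xA xlt] As gs; split=> [i|i j]; rewrite /insert_at.
  by case: unliftP.
case: unliftP => [i' ->|->]; case: unliftP => [j' ->|->] /=.
- by rewrite ltn_bump2 => /xlt.
- by rewrite /bump; case: leqP (gs i') => // ki; rewrite add1n ltnNge ltnW.
- by rewrite /bump; case: leqP (gs j') => // jk; rewrite add0n ltnNge ltnW.
- by rewrite ltnn.
Qed.

Lemma increasing_rcons (R : realType) (A : set R) m (x : 'I_m.+1 -> R) t :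
  increasing_in A x -> A t -> x ord_max < t ->
  increasing_in A (insert_at ord_max t x).
Proof.
move=> xinc At xt; apply: increasing_insert => // i; rewrite ltn_ord.
by apply: le_lt_trans xt; apply: increasing_le xinc _; rewrite -ltnS.
Qed.

(** * The alternating functional attached to n + 1 points *)

(** The Laplace expansion, along its last row, of the determinant with rows
    w_1, ..., w_n, g and columns z_0, ..., z_n. *)
Definition gdiff {R : realType} {n : nat} (w : 'I_n -> R -> R)
    (z : 'I_n.+1 -> R) (g : R -> R) : R :=
  \sum_(j < n.+1) (-1) ^+ (n + j) * Vdet w (z \o lift j) * g (z j).

(** With g = w_i the expanded determinant has two equal rows. *)
Lemma gdiff_basis (R : realType) n (w : 'I_n -> R -> R) (z : 'I_n.+1 -> R) i :
  gdiff w z (w i) = 0.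
Proof.
pose M := \matrix_(a < n.+1, b < n.+1)
  (if unlift ord_max a is Some a' then w a' (z b) else w i (z b)).
have <- : \det M = 0.
  apply: (determinant_alternate (i1 := lift ord_max i) (i2 := ord_max)).
    by rewrite eq_sym neq_lift.
  by move=> b; rewrite !mxE liftK unlift_none.
rewrite (expand_det_row _ ord_max); apply: eq_bigr => j _.
rewrite mxE unlift_none /cofactor mulrC; congr (_ * (_ * \det _)).
by apply/matrixP => a b; rewrite !mxE liftK.
Qed.

Lemma gdiff_lincomb (R : realType) n (w : 'I_n -> R -> R) (z : 'I_n.+1 -> R) c :
  gdiff w z (lincomb w c) = 0.
Proof.
rewrite /gdiff /lincomb.
under eq_bigr => j _ do rewrite mulr_sumr.
rewrite exchange_big big1 // => i _.
transitivity (c i * gdiff w z (w i)); last by rewrite gdiff_basis mulr0.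
by rewrite mulr_sumr; apply: eq_bigr => j _; rewrite mulrCA.
Qed.

Lemma gdiffB_lincomb (R : realType) n (w : 'I_n -> R -> R)
    (z : 'I_n.+1 -> R) (f : R -> R) c :
  gdiff w z (fun t => f t - lincomb w c t) = gdiff w z f.
Proof.
rewrite -[RHS]subr0 -(gdiff_lincomb w z c) /gdiff -sumrB.
by apply: eq_bigr => j _; rewrite mulrBr.
Qed.

Lemma gdiff1 (R : realType) n (w : 'I_n -> R -> R) (z : 'I_n.+1 -> R) g k :
  (forall j, j != k -> g (z j) = 0) ->
  gdiff w z g = (-1) ^+ (n + k) * Vdet w (z \o lift k) * g (z k).
Proof.
move=> g0; rewrite /gdiff (bigD1 k) //= big1 ?addr0 // => j jk.
by rewrite g0 // mulr0.
Qed.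

Lemma gdiff2 (R : realType) n (w : 'I_n -> R -> R) (z : 'I_n.+1 -> R) g k :
  k != ord_max -> (forall j, j != k -> j != ord_max -> g (z j) = 0) ->
  gdiff w z g = (-1) ^+ (n + k) * Vdet w (z \o lift k) * g (z k)
              + Vdet w (z \o lift ord_max) * g (z ord_max).
Proof.
move=> kmax g0; rewrite /gdiff (bigD1 k) //= (bigD1 ord_max) 1?eq_sym //=.
rewrite big1 => [|j /andP[jk jm]]; last by rewrite g0 // mulr0.
by rewrite addr0 addnn -mul2n mulnC exprM sqrr_sign mul1r.
Qed.

(** Interpolate f at all points of an increasing tuple but the one at position
    k: there, f - omega has the sign of [gdiff], times the alternating sign of
    its k-th coefficient.  Leaving out the last point already gives the
    nonnegativity of [gdiff]; as k varies, the converse yields all the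
    inequalities of convexity. *)
Lemma omega_convexP (R : realType) (I : set R) n (w : 'I_n.+1 -> R -> R)
    (hw : positive_chebyshev_system I w) f :
  omega_convex I w f <-> (forall z, increasing_in I z -> 0 <= gdiff w z f).
Proof.
have wV := hw.2; split=> [fcvx z zinc|fdiff y yinc c yc t It].
- have yinc := increasing_lift ord_max zinc.
  have [c [yc _]] := interpolation_unique_existence f
    (positive_chebyshev_chebyshev hw) yinc.
  rewrite -(gdiffB_lincomb _ _ _ c) (@gdiff1 _ _ _ _ _ ord_max); last first.
    move=> j; rewrite eq_sym => /unlift_some[i -> _].
    by have /= -> := yc i; rewrite subrr.
  rewrite addnn -mul2n mulnC exprM sqrr_sign mul1r.
  rewrite mulr_ge0 ?(ltW (wV _ yinc)) //.
  have [_ _ /(_ ord_max erefl)] := fcvx _ yinc _ yc _ (zinc.1 ord_max).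
  by apply; apply/ltW/zinc.2; rewrite lift_max /=.
- have at_node i : f (y i) - lincomb w c (y i) = 0 by rewrite yc subrr.
  have sgn (k : 'I_n.+2) : in_gap y k t ->
      0 <= (-1) ^+ (n.+1 + k) * (f t - lincomb w c t).
    move=> gt; have zinc := increasing_insert yinc It gt.
    have := fdiff _ zinc; rewrite -(gdiffB_lincomb _ _ _ c).
    rewrite (@gdiff1 _ _ _ _ _ k) => [|j]; last first.
      by rewrite eq_sym => /unlift_some[i -> _]; rewrite insert_at_lift.
    rewrite insert_at_comp_lift insert_at_same -mulrA mulrCA.
    by rewrite pmulr_rge0 // wV.
  split=> [i i0|i j ij|i [iE]].
  + rewrite le_eqVlt => /orP[/eqP->|ti]; first by rewrite at_node mulr0.
    have := sgn ord0; rewrite addn0; apply=> i' /=.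
    by apply: lt_le_trans ti _; apply: increasing_le yinc _; rewrite i0.
  + rewrite (le_eqVlt (y i)) (le_eqVlt t) => /andP[/orP[/eqP<- _|it]].
      by rewrite at_node mulr0.
    move=> /orP[/eqP->|tj]; first by rewrite at_node mulr0.
    have := sgn (widen_ord (leqnSn _) j); apply=> i' /=.
    case: ltnP => [i'j|ji']; last first.
      by apply: lt_le_trans tj _; apply: increasing_le yinc ji'.
    apply: le_lt_trans it; apply: increasing_le yinc _.
    by rewrite -ltnS -ij.
  + rewrite le_eqVlt => /orP[/eqP<-|it]; first by rewrite at_node.
    have := sgn ord_max; rewrite /= addnn -mul2n mulnC exprM sqrr_sign mul1r.
    apply=> i'; rewrite ltn_ord; apply: le_lt_trans it.
    by apply: increasing_le yinc _; rewrite iE -ltnS.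
Qed.

(** * Interpolants through n - 1 points *)

(** As a function of t, a combination of the w_i vanishing at the nodes x_i.
    For a positive Chebyshev system it is positive to their right, and moving
    the last column to its sorted place shows that it changes sign at every
    node. *)
Definition nodal {R : realType} {p : nat} (w : 'I_p.+1 -> R -> R)
    (x : 'I_p -> R) (t : R) : R :=
  Vdet w (insert_at ord_max t x).

(** Expand the determinant along its last column, the only one in which t
    occurs. *)
Lemma nodal_lincomb (R : realType) p (w : 'I_p.+1 -> R -> R) (x : 'I_p -> R) :
  exists c, forall t, nodal w x t = lincomb w c t.
Proof.
pose M t := \matrix_(i < p.+1, j < p.+1) w i (insert_at ord_max t x j).
exists (fun i => cofactor (M 0) i ord_max) => t.
rewrite /nodal /Vdet (expand_det_col _ ord_max); apply: eq_bigr => i _.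
rewrite mxE insert_at_same mulrC; congr (_ * _); rewrite /cofactor.
congr (_ * \det _); apply/matrixP => a b.
by rewrite !mxE !insert_at_lift.
Qed.

Lemma nodal_eq0 (R : realType) p (w : 'I_p.+1 -> R -> R) (x : 'I_p -> R) i :
  nodal w x (x i) = 0.
Proof.
rewrite /nodal /Vdet -det_tr.
apply: (determinant_alternate (i1 := lift ord_max i) (i2 := ord_max)).
  by rewrite eq_sym neq_lift.
by move=> b; rewrite !mxE insert_at_lift insert_at_same.
Qed.

(** Adding s in the gap k and t on the right gives n + 1 points, at which g has
    only two nonzero values.  Omitting s leaves the nodes followed by t, hence
    the factor [nodal w x t]; of the other coefficient B only the sign
    matters. *)
Lemma gdiff_two_inserted (R : realType) (I : set R) p (w : 'I_p.+2 -> R -> R)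
    (hw : positive_chebyshev_system I w) (x : 'I_p.+1 -> R) (k : 'I_p.+1) s t :
  increasing_in I x -> I s -> I t -> in_gap x k s -> x ord_max < t ->
  exists2 z, increasing_in I z & exists2 B, 0 < B &
    forall g, (forall i, g (x i) = 0) ->
    gdiff w z g = (-1) ^+ (p.+2 + k) * nodal w x t * g s + B * g t.
Proof.
move=> xinc Is It xs xt; have wV := hw.2.
pose y := insert_at ord_max t x; pose k' := widen_ord (leqW (leqnSn _)) k.
have yinc : increasing_in I y by exact: increasing_rcons.
have ys : in_gap y k' s.
  move=> i; rewrite /y /insert_at; case: unliftP => [i' ->|->].
    by rewrite lift_max; exact: xs.
  rewrite ltnNge ltnW //=; apply: lt_trans xt; move: (xs ord_max).
  by rewrite /= ltnNge -ltnS ltn_ord.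
pose z := insert_at k' s y.
have zinc : increasing_in I z by exact: increasing_insert.
exists z => //; exists (Vdet w (z \o lift ord_max)).
  by apply: wV; exact: increasing_lift.
have k'max : k' != ord_max by rewrite -val_eqE /= ltn_eqF // ltnW // ltnS.
have kmax : lift k' ord_max = ord_max.
  by apply/val_inj; rewrite /= /bump ltnW.
move=> g g0; rewrite (@gdiff2 _ _ _ _ _ k') // => [|j].
  rewrite {1 2}/z insert_at_comp_lift insert_at_same; congr (_ + _ * g _).
  by rewrite -kmax /z insert_at_lift /y insert_at_same.
rewrite eq_sym => /unlift_some[i -> _] imax.
rewrite /z insert_at_lift /y.
have /unlift_some[i' -> _] : ord_max != i.
  by apply: contraNneq imax => <-; rewrite kmax.
by rewrite insert_at_lift.
Qed.

(** * Supporting combinations *)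

Lemma separating_real (R : realType) (A B : set R) :
  A !=set0 -> B !=set0 -> (forall a b, A a -> B b -> a <= b) ->
  exists c, (forall a, A a -> a <= c) /\ (forall b, B b -> c <= b).
Proof.
move=> A0 [b0 Bb0] AB; exists (sup A); split=> [a Aa|b Bb].
  by apply: ub_le_sup => //; exists b0 => a' Aa'; exact: AB.
by apply: ge_sup => // a Aa; exact: AB.
Qed.

Lemma interval_interior (R : realType) (I : set R) (a b c : R) :
  is_interval I -> I a -> I c -> a < b -> b < c -> interior I b.
Proof.
move=> hI Ia Ic ab bc.
have := @near_in_itvoo R a c b; rewrite in_itv /= ab bc => /(_ isT).
apply: filterS => y; rewrite in_itv /= => /andP[ay yc].
by apply: (hI a c) => //; rewrite !ltW.
Qed.

Lemma interior_straddle (R : realType) (I : set R) (a : R) :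
  interior I a -> (exists2 s, I s & s < a) /\ (exists2 t, I t & a < t).
Proof.
move=> /nbhs_ballP[e /= e0 aI]; split.
- exists (a - e / 2); last by rewrite ltrBlDr ltrDl divr_gt0.
  apply: aI; rewrite /ball /= opprB addrC subrK gtr0_norm ?divr_gt0 //.
  by rewrite ltr_pdivrMr // ltr_pMr // ltr1n.
- exists (a + e / 2); last by rewrite ltrDl divr_gt0.
  apply: aI; rewrite /ball /= opprD addNKr normrN gtr0_norm ?divr_gt0 //.
  by rewrite ltr_pdivrMr // ltr_pMr // ltr1n.
Qed.

(** The gap numbered k lies just before x_k, so the condition below covers all
    points of I to the left of the last x_i except the x_i themselves. *)
Definition supports {R : realType} {p : nat} (I : set R)
    (w : 'I_p.+2 -> R -> R) (f : R -> R) (x : 'I_p.+1 -> R)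
    (c : 'I_p.+2 -> R) : Prop :=
  [/\ forall i, lincomb w c (x i) = f (x i),
      forall (k : 'I_p.+1) s, I s -> in_gap x k s ->
        0 <= (-1) ^+ (p.+2 + k) * (f s - lincomb w c s)
    & forall t, I t -> x ord_max < t -> 0 <= f t - lincomb w c t].

(** A combination a + c nodal supports f when c separates the values of
    (f - a) / nodal left of the last node from those right of it.  As the nodes
    are interior, there are points of I on both sides, so the supremum of the
    left values is a real number that does this. *)
Lemma supports_exists (R : realType) (I : set R) p (w : 'I_p.+2 -> R -> R)
    (hw : positive_chebyshev_system I w) f x :
  omega_convex I w f -> increasing_in (interior I) x ->
  exists c, supports I w f x c.
Proof.
move=> /(omega_convexP hw) fdiff xinc0.
have xinc : increasing_in I x.
  by case: xinc0 => xI xlt; split=> // i; exact: interior_subset.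
have [[s0 Is0 s0x] _] := interior_straddle (xinc0.1 ord0).
have [_ [t0 It0 xt0]] := interior_straddle (xinc0.1 ord_max).
have s0gap : in_gap x (@ord0 p) s0.
  by move=> i; apply: lt_le_trans s0x _; apply: increasing_le xinc _.
have [a [ax _]] := interpolation_unique_existence f
  (positive_chebyshev_chebyshev hw) (increasing_rcons xinc It0 xt0).
have {}ax i : lincomb w a (x i) = f (x i).
  by have := ax (lift ord_max i); rewrite insert_at_lift.
have [b bE] := nodal_lincomb w x.
pose g t := f t - lincomb w a t; pose phi := nodal w x.
have gx i : g (x i) = 0 by rewrite /g ax subrr.
have phi_right t : I t -> x ord_max < t -> 0 < phi t.
  by move=> It xt; apply: hw.2; exact: increasing_rcons.
have phi0 z : gdiff w z phi = 0.
  by rewrite -(gdiff_lincomb w z b); apply: eq_bigr => j _; rewrite /phi bE.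
pose e k : R := (-1) ^+ (p.+2 + k).
(* Since gdiff z phi = 0 determines the coefficient B of the value at t, gdiff z
   g >= 0 becomes an inequality between two quotients. *)
have key (k : 'I_p.+1) s t : I s -> in_gap x k s -> I t -> x ord_max < t ->
    e k * phi s < 0 /\ g s / phi s <= g t / phi t.
  move=> Is xs It xt.
  have [z zinc [B B0 zE]] := gdiff_two_inserted hw xinc Is It xs xt.
  have pt := phi_right t It xt.
  have := phi0 z; rewrite (zE _ (nodal_eq0 w x)) -/phi -/(e k).
  move=> /eqP; rewrite addrC addr_eq0 mulrAC => /eqP; rewrite (mulrC B) => ps.
  have BE : B = - (e k * phi s).
    by apply: (mulfI (lt0r_neq0 pt)); rewrite ps mulrN [in RHS]mulrC.
  have neg : e k * phi s < 0 by rewrite -oppr_gt0 -BE.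
  split=> //.
  have := fdiff _ zinc; rewrite -(gdiffB_lincomb _ _ _ a) -/g (zE _ gx).
  rewrite -/phi -/(e k).
  rewrite BE => main.
  have -> : g s / phi s = (e k * g s) / (e k * phi s).
    by rewrite -mulf_div divff ?mul1r // signr_eq0.
  rewrite ler_ndivrMr // mulrAC ler_pdivrMr // -subr_ge0.
  by move: main; rewrite mulNr mulrAC [g t * _]mulrC.
pose S := [set q | exists2 s, I s /\ (exists k : 'I_p.+1, in_gap x k s)
                   & q = g s / phi s].
pose T := [set q | exists2 t, I t /\ x ord_max < t & q = g t / phi t].
have [||u v|c [Sc Tc]] := @separating_real _ S T.
- by exists (g s0 / phi s0), s0 => //; split=> //; exists ord0.
- by exists (g t0 / phi t0), t0.
- move=> [s [Is [k xs]] ->] [t [It xt] ->].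
  by case: (key k s t Is xs It xt).
have omegaE t :
    lincomb w (fun i => a i + c * b i) t = lincomb w a t + c * phi t.
  rewrite /phi bE /lincomb mulr_sumr -big_split; apply: eq_bigr => i _ /=.
  by rewrite mulrDl mulrA.
exists (fun i => a i + c * b i); split=> [i|k s Is xs|t It xt].
- by rewrite omegaE ax /phi nodal_eq0 mulr0 addr0.
- have [neg _] := key k s t0 Is xs It0 xt0.
  have phis0 : phi s != 0.
    by apply: contraTneq neg => ->; rewrite mulr0 ltxx.
  have : g s / phi s <= c by apply: Sc; exists s => //; split=> //; exists k.
  rewrite omegaE opprD addrA -/(g s) -/(e k) -subr_le0.
  have -> : g s / phi s - c = (g s - c * phi s) / phi s.
    by rewrite [RHS]mulrBl mulfK.
  move=> q0; have -> : e k * (g s - c * phi s) =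
    (e k * phi s) * ((g s - c * phi s) / phi s).
    by rewrite -mulrA [phi s * _]mulrC divfK.
  by rewrite mulr_le0 // ltW.
- rewrite omegaE opprD addrA -/(g t) subr_ge0 -ler_pdivlMr ?phi_right //.
  by apply: Tc; exists t.
Qed.

(** The first and last of n + 1 points enclose the n - 1 others, which are
    therefore interior even if the outer two are end points of I. *)
Lemma omega_convex_of_supports (R : realType) (I : set R) (hI : is_interval I)
    p (w : 'I_p.+2 -> R -> R) (hw : positive_chebyshev_system I w) f :
  (forall x, increasing_in (interior I) x -> exists c, supports I w f x c) ->
  omega_convex I w f.
Proof.
move=> fsup; apply/(omega_convexP hw) => z zinc; have wV := hw.2.
pose x (i : 'I_p.+1) := z (lift ord0 (lift ord_max i)).
have z0x i : z ord0 < x i by apply: zinc.2.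
have xzn i : x i < z ord_max by apply: zinc.2; rewrite lift0 lift_max ltnS.
have xinc : increasing_in (interior I) x.
  split=> [i|i j ij]; last by apply: zinc.2; rewrite /= !ltn_bump2.
  exact: (interval_interior hI (zinc.1 ord0) (zinc.1 ord_max)).
have [c [cx cl cr]] := fsup x xinc.
rewrite -(gdiffB_lincomb _ _ _ c) (@gdiff2 _ _ _ _ _ ord0) // => [|j j0 jm].
  have Vge0 k : 0 <= Vdet w (z \o lift k).
    by apply/ltW/wV; exact: increasing_lift.
  apply: addr_ge0; last first.
    by apply: mulr_ge0 => //; exact: cr (zinc.1 _) (xzn _).
  rewrite -mulrA mulrCA; apply: mulr_ge0 => //.
  by apply: (cl ord0 _ (zinc.1 _)) => i; exact: z0x.
move: j0 jm; rewrite eq_sym => /unlift_some[i -> _] imax.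
have /unlift_some[i' -> _] : ord_max != i.
  by apply: contraNneq imax => <-; apply/eqP/val_inj.
by rewrite -/(x i') cx subrr.
Qed.

(* The points x_1, ..., x_(n-1) are indexed from 0: for j = i + 1 below, the
   piece x_(k-1) < t < x_k has k = j + 1. *)
Theorem theorem3 (R : realType) (n : nat) (hn : (2 <= n)%N)
    (I : set R) (hI : is_interval I) (w : 'I_n -> R -> R)
    (hw : positive_chebyshev_system I w)
    (hw' : positive_chebyshev_system I (drop_last w))
    (f : R -> R) :
  omega_convex I w f <->
  (forall x : 'I_n.-1 -> R, increasing_in (interior I) x ->
   exists c : 'I_n -> R,
     (forall k, lincomb w c (x k) = f (x k)) /\
     (forall t, I t ->
      [/\ forall i : 'I_n.-1, i = 0%N :> nat -> t < x i ->
            (-1) ^+ n.-1 * (f t - lincomb w c t) <= 0,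
          forall i j : 'I_n.-1, j = i.+1 :> nat -> x i < t < x j ->
            (-1) ^+ (n - j.+1) * (f t - lincomb w c t) <= 0
        & forall i : 'I_n.-1, i.+1 = n.-1 -> x i < t ->
            f t - lincomb w c t >= 0])).
Proof.
case: n hn w hw hw' => [|[|p]] // hn w hw hw'.
(* The exponents n - (k + 1) and n + k have opposite parities. *)
have sgn_opp (k : nat) (a : R) : (k < p.+2)%N ->
    (-1) ^+ (p.+2 - k.+1) * a = - ((-1) ^+ (p.+2 + k) * a).
  move=> kp; have -> : (p.+2 + k = p.+2 - k.+1 + (k + k).+1)%N.
    by rewrite -{1}(subnK kp) -addnA addSn.
  rewrite exprD exprS addnn -mul2n exprM sqrrN !expr1n.
  by rewrite mulr1 mulrN1 mulNr opprK.
split=> [fcvx x xinc|fsup].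
- have [c [cx cl cr]] := supports_exists hw fcvx xinc.
  have xle (i j : 'I_p.+1) : (i <= j)%N -> x i <= x j := increasing_le xinc.
  exists c; split=> // t It; split=> [i i0 ti|i j ij /andP[it tj]|i [iE] it].
  + rewrite (sgn_opp 0%N) // oppr_le0; apply: (cl ord0) => // i'.
    by apply: lt_le_trans ti _; apply: xle; rewrite i0.
  + rewrite (sgn_opp j) ?(leqW (ltn_ord j)) // oppr_le0; apply: cl => // i'.
    case: ltnP => [i'j|ji']; last by apply: lt_le_trans tj _; exact: xle.
    by apply: le_lt_trans it; apply: xle; rewrite -ltnS -ij.
  + apply: cr => //; apply: le_lt_trans it; apply: xle.
    by rewrite iE.
- apply: (omega_convex_of_supports hI hw) => x xinc.
  have [c [cx csup]] := fsup x xinc; exists c; split=> // [k s Is xs|t It xt].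
    have [c0 cin _] := csup s Is.
    rewrite -oppr_le0 -sgn_opp; last by rewrite ltnS ltnW.
    case: k xs => [[|k] kp] xs; last first.
      have kp' : (k < p.+1)%N by exact: ltnW.
      apply: (cin (Ordinal kp') (Ordinal kp)) => //; apply/andP; split.
        by have := xs (Ordinal kp'); rewrite /= ltnSn.
      by have := xs (Ordinal kp); rewrite /= ltnn.
    by apply: (c0 (Ordinal kp)) => //; have := xs (Ordinal kp).
  by have [_ _ cr] := csup t It; apply: (cr ord_max).
Qed.
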